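(* Fix $\varepsilon>0$ and a dataset $D=\{(x_i,y_i)\}_{i=1}^n$ with $x_i,y_i\in[0,1]$. With the noisy statistics and $\tilde n_y$ defined in the context, define $\hat S_{x}:=\frac23\bigl(\tilde S_{x^2}+\tilde S_{x-x^2}\bigr)+\frac13\bigl(\tilde n_y-\tilde S_{1-x}\bigr)$. Then $\hat S_x$ is an unbiased estimator of $S_x=\sum_i x_i$ with variance $\mathrm{Var}(\hat S_x)=\frac{32}{3\varepsilon^2}$.
   Context: Let $\varepsilon_1=\varepsilon_2=\varepsilon/2$. Define the statistics $S_{x^2}=\sum_i x_i^2$, $S_{x-x^2}=\sum_i (x_i-x_i^2)$, $S_{1-x}=\sum_i(1-x_i)$, $S_{xy}=\sum_i x_iy_i$, $S_{(1-x)y}=\sum_i (1-x_i)y_i$, $S_{1-y}=\sum_i(1-y_i)$. Let $Z_{11},Z_{12},Z_{13}\stackrel{iid}{\sim}\mathrm{Lap}(1/\varepsilon_1)$ and $Z_{21},Z_{22},Z_{23}\stackrel{iid}{\sim}\mathrm{Lap}(1/\varepsilon_2)$, all six mutually independent, where $\mathrm{Lap}(b)$ is the zero-mean Laplace distribution with density $\frac{1}{2b}e^{-|z|/b}$. Set $\tilde S_{x^2}=S_{x^2}+Z_{11}$, $\tilde S_{x-x^2}=S_{x-x^2}+Z_{12}$, $\tilde S_{1-x}=S_{1-x}+Z_{13}$, $\tilde S_{xy}=S_{xy}+Z_{21}$, $\tilde S_{(1-x)y}=S_{(1-x)y}+Z_{22}$, $\tilde S_{1-y}=S_{1-y}+Z_{23}$,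 and $\tilde n_x=\tilde S_{x^2}+\tilde S_{x-x^2}+\tilde S_{1-x}$, $\tilde n_y=\tilde S_{xy}+\tilde S_{(1-x)y}+\tilde S_{1-y}$. The dataset is fixed; expectations and variances are over the noise. *)

(* Defs.v *)
From HB Require Import structures.
From mathcomp Require Import all_boot all_order all_algebra.
From mathcomp Require Import all_classical all_reals all_analysis.
Set Implicit Arguments. Unset Strict Implicit. Unset Printing Implicit Defensive.
Import Order.TTheory GRing.Theory Num.Theory.
Local Open Scope classical_set_scope.
Local Open Scope ring_scope.

Definition laplace_pdf {R : realType} (b : R) (z : R) : R :=
  (2 * b)^-1 * expR (- `|z| / b).

Definition has_laplace_law {d} {T : measurableType d} {R : realType}
  (P : probability T R) (X : {RV P >-> R}) (b : R) : Prop :=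
  forall A : set R, measurable A ->
    distribution P X A = (\int[lebesgue_measure]_(z in A) (laplace_pdf b z)%:E)%E.

(* Mutual independence of a finite family of real random variables:
   the joint law of preimages of measurable sets factorises. (Taking A i = setT
   for unused indices gives the product rule for every subfamily.) *)
Definition mutually_independent {d} {T : measurableType d} {R : realType}
  (P : probability T R) (k : nat) (Z : 'I_k -> {RV P >-> R}) : Prop :=
  forall A : 'I_k -> set R, (forall i, measurable (A i)) ->
    P (\bigcap_i (Z i @^-1` A i)) = (\prod_(i < k) P (Z i @^-1` A i))%E.

Section stats.
Context {R : realType} (n : nat) (x y : 'I_n -> R).
Definition S_x   : R := \sum_i x i.
Definition S_x2  : R := \sum_i x i ^+ 2.
Definition S_xmx2 : R := \sum_i (x i - x i ^+ 2).
Definition S_1mx : R := \sum_i (1 - x i).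
Definition S_xy  : R := \sum_i x i * y i.
Definition S_1mxy : R := \sum_i (1 - x i) * y i.
Definition S_1my : R := \sum_i (1 - y i).
End stats.

(* Noise vector: Z ord 0,1,2 = Z_11, Z_12, Z_13 ; Z ord 3,4,5 = Z_21, Z_22, Z_23. *)
Section noisy.
Context {d} {T : measurableType d} {R : realType} (P : probability T R)
  (n : nat) (x y : 'I_n -> R) (Z : 'I_6 -> {RV P >-> R}).
Definition tS_x2   (w : T) : R := S_x2 x + Z (@Ordinal 6 0 isT) w.
Definition tS_xmx2 (w : T) : R := S_xmx2 x + Z (@Ordinal 6 1 isT) w.
Definition tS_1mx  (w : T) : R := S_1mx x + Z (@Ordinal 6 2 isT) w.
Definition tS_xy   (w : T) : R := S_xy x y + Z (@Ordinal 6 3 isT) w.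
Definition tS_1mxy (w : T) : R := S_1mxy x y + Z (@Ordinal 6 4 isT) w.
Definition tS_1my  (w : T) : R := S_1my y + Z (@Ordinal 6 5 isT) w.
Definition tn_x (w : T) : R := tS_x2 w + tS_xmx2 w + tS_1mx w.
Definition tn_y (w : T) : R := tS_xy w + tS_1mxy w + tS_1my w.
Definition hatS_x (w : T) : R :=
  2 / 3 * (tS_x2 w + tS_xmx2 w) + 1 / 3 * (tn_y w - tS_1mx w).
End noisy.

(* Main.v *)
(** Both parts of the estimator are centred at S_x: S_{x^2} + S_{x-x^2} = S_x, and
    S_{xy} + S_{(1-x)y} + S_{1-y} = n = S_x + S_{1-x}. Independent noise is
    uncorrelated, so with b = 2 / eps the variance is
    (2 (2/3)^2 + 4 (1/3)^2) 2 b^2 = 8 b^2 / 3. *)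
Require Import Defs.
From HB Require Import structures.
From mathcomp Require Import all_boot all_order all_algebra.
From mathcomp Require Import all_classical all_reals all_analysis.
From mathcomp Require Import measurable_realfun ring lra.
Set Implicit Arguments.
Unset Strict Implicit.
Unset Printing Implicit Defensive.
Import Order.TTheory GRing.Theory Num.Theory.
Import numFieldNormedType.Exports.
Local Open Scope classical_set_scope.
Local Open Scope ring_scope.

(** * Integration against a measure given by a density *)

Section density.
Context d (T : measurableType d) (R : realType).
Variables (mu : {sigma_finite_measure set T -> \bar R})
          (nu : {finite_measure set T -> \bar R}) (g : T -> R).
Hypotheses (mg : measurable_fun setT g) (g0 : forall x, 0 <= g x)
  (nuE : forall A, measurable A -> nu A = (\int[mu]_(x in A) (g x)%:E)%E).

(** Both [g] and the Radon-Nikodym derivative of [nu] have integral [nu A] over every measurable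
    [A], so they agree almost everywhere; the change of variables formula for the derivative then
    holds for [g]. *)
Lemma ge0_integral_density (f : T -> \bar R) :
  measurable_fun setT f -> (forall x, (0 <= f x)%E) ->
  (\int[nu]_x f x = \int[mu]_x (f x * (g x)%:E))%E.
Proof.
move=> mf f0.
have mEg : measurable_fun setT (EFin \o g) by exact/measurable_EFinP.
have numu : nu `<< mu.
  apply/null_content_dominatesP => A mA muA0.
  by rewrite nuE// null_set_integral//; exact: measurable_funTS.
(* The total integral of [g] is [nu setT], which is finite. *)
have ig : mu.-integrable setT (EFin \o g).
  apply/integrableP; split => //.
  under eq_integral do rewrite /= ger0_norm//.
  by rewrite -nuE// -ge0_fin_numE// fin_num_measure.
rewrite -(@Radon_Nikodym_SigmaFinite.change_of_variables _ _ _ _ _ numu)//.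
have iRN := Radon_Nikodym_SigmaFinite.f_integrable numu.
apply: ae_eq_integral => //.
- by apply: emeasurable_funM => //; exact: measurable_int iRN.
- exact: emeasurable_funM.
apply: ae_eqe_mul2l; apply: integral_ae_eq => //.
by move=> E _ mE; rewrite -Radon_Nikodym_SigmaFinite.f_integral// nuE.
Qed.

End density.

(** * Moments of the Laplace density *)

Section laplace.
Context (R : realType).
Implicit Types b z : R.
Notation mu := (@lebesgue_measure R).

Lemma laplace_pdf_ge0 b z : 0 < b -> 0 <= laplace_pdf b z.
Proof.
by move=> b0; rewrite /laplace_pdf mulr_ge0 ?expR_ge0// invr_ge0 mulr_ge0// ltW.
Qed.

Lemma continuous_laplace_pdf b : continuous (laplace_pdf b).
Proof.
move=> z; apply: cvgMr.
apply: continuous_comp; last exact: continuous_expR.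
apply: cvgMl; apply: cvgN; exact: norm_continuous.
Qed.

Lemma laplace_pdfN b z : laplace_pdf b (- z) = laplace_pdf b z.
Proof. by rewrite /laplace_pdf normrN. Qed.

(** Boundary term at infinity for the second moment. The cubic term of the exponential series gives
    exp(z/b) >= (z/b)^3/6, so the product is O(1/z). *)
Lemma cvgy_quadratic_expRN b : 0 < b ->
  (z ^+ 2 / 2 + b * z + b ^+ 2) * expR (- z / b) @[z --> +oo] --> 0.
Proof.
move=> b0; apply/cvgrPdist_le => e e0; near=> z.
have zb : b <= z by near: z; apply: nbhs_pinfty_ge; exact: num_real.
(* The final bound is 15 b^3 / z, the product of 5/2 z^2 and 6 b^3 / z^3. *)
have ze : 15 * b ^+ 3 / e <= z by near: z; apply: nbhs_pinfty_ge; exact: num_real.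
have z0 : 0 < z by exact: lt_le_trans zb.
rewrite sub0r normrN ger0_norm; last first.
  by rewrite mulr_ge0 ?expR_ge0// ?addr_ge0// ?mulr_ge0 ?sqr_ge0 ?ltW.
have expz : expR (- z / b) <= 6 * b ^+ 3 / z ^+ 3.
  rewrite mulNr expRN -[leRHS]invrK lef_pV2 ?posrE ?expR_gt0//; last first.
    by rewrite invr_gt0 divr_gt0// ?mulr_gt0 ?exprn_gt0.
  have := @expR_ge1Dxn R (z / b) 2 (divr_ge0 (ltW z0) (ltW b0)).
  apply: le_trans; rewrite -[leLHS]add0r lerD//.
  rewrite le_eqVlt; apply/orP; left; apply/eqP.
  by rewrite (_ : 3`!%:R = 6)//; field; rewrite !gt_eqF.
(* From b <= z, the last two terms are at most z^2 each. *)
have quad : z ^+ 2 / 2 + b * z + b ^+ 2 <= 5 / 2 * z ^+ 2 by nra.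
apply: (@le_trans _ _ (5 / 2 * z ^+ 2 * (6 * b ^+ 3 / z ^+ 3))).
  by apply: ler_pM => //; rewrite ?expR_ge0// ?addr_ge0// ?mulr_ge0 ?sqr_ge0 ?ltW.
have -> : 5 / 2 * z ^+ 2 * (6 * b ^+ 3 / z ^+ 3) = 15 * b ^+ 3 / z.
  by field; rewrite gt_eqF.
by rewrite ler_pdivrMr// [leRHS]mulrC -ler_pdivrMr//.
Unshelve. all: by end_near. Qed.

Lemma laplace_pdf_second_moment_pos b : 0 < b ->
  (\int[mu]_(z in `[0%R, +oo[) (z ^+ 2 * laplace_pdf b z)%:E = (b ^+ 2)%:E)%E.
Proof.
(* Antiderivative obtained by integrating by parts twice; it runs from -b^2 at 0 to 0 at
   infinity. *)
move=> b0; pose F z := - ((z ^+ 2 / 2 + b * z + b ^+ 2) * expR (- z / b)).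
have dF z : is_derive z 1 F (z ^+ 2 * (2 * b)^-1 * expR (- z / b)).
  rewrite /F; apply: is_derive_eq.
  rewrite /GRing.scale /=; field.
  by rewrite gt_eqF.
rewrite (@ge0_continuous_FTC2y _ _ F 0 0).
- rewrite -EFinB /F oppr0 mul0r expR0; congr EFin; ring.
- by move=> z _; rewrite mulr_ge0 ?sqr_ge0 ?laplace_pdf_ge0.
- apply: continuous_subspaceT => z; apply: cvgM; last exact: continuous_laplace_pdf.
  exact: exprn_continuous.
- by rewrite -[0]oppr0; apply: cvgN; exact: cvgy_quadratic_expRN.
- by move=> z _; have [] := dF z.
- apply: cvg_at_right_filter; apply: differentiable_continuous.
  by apply/derivable1_diffP; have [] := dF 0.
- move=> z; rewrite in_itv/= andbT => z0; rewrite derive1E; have [_ ->] := dF z.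
  by rewrite /laplace_pdf gtr0_norm// mulrA.
Qed.

Lemma laplace_pdf_second_moment b : 0 < b ->
  (\int[mu]_z (z ^+ 2 * laplace_pdf b z)%:E = (2 * b ^+ 2)%:E)%E.
Proof.
move=> b0; rewrite ge0_symfun_integralT.
- by rewrite -set_itvcy laplace_pdf_second_moment_pos// EFinM.
- by move=> z; rewrite mulr_ge0 ?sqr_ge0 ?laplace_pdf_ge0.
- move=> z; apply: cvgM; last exact: continuous_laplace_pdf.
  exact: exprn_continuous.
- by move=> z /=; rewrite laplace_pdfN sqrrN.
Qed.

(** Reflection z -> -z exchanges the positive and negative parts of z and fixes the density. Working
    with the two parts keeps every integrand nonnegative. *)
Lemma laplace_pdf_first_moment_sym b : 0 < b ->
  (\int[mu]_z (Num.max z 0 * laplace_pdf b z)%:E =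
   \int[mu]_z (Num.max (- z) 0 * laplace_pdf b z)%:E)%E.
Proof.
move=> b0.
transitivity (\int[mu]_(z in `[0%R, +oo[) (Num.max z 0 * laplace_pdf b z)%:E)%E.
  rewrite [RHS]integral_mkcond; apply: eq_integral => z _.
  rewrite patchE; case: ifPn => //; rewrite notin_setE/= in_itv/= andbT => /negP.
  by rewrite -ltNge => z0; rewrite max_r ?mul0r// ltW.
(* The endpoint is written [- 0] to match the reflected half-line in the substitution rule. *)
transitivity (\int[mu]_(z in `]-oo, (- 0)%R]) (Num.max (- z) 0 * laplace_pdf b z)%:E)%E.
  rewrite ge0_integration_by_substitutionNy.
  - by apply: eq_integral => z _ /=; rewrite opprK laplace_pdfN.
  - apply: continuous_subspaceT => z; apply: cvgM; last exact: continuous_laplace_pdf.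
    by apply: continuous_max; [exact: continuousN|exact: cvg_cst].
  - by move=> z _; rewrite mulr_ge0 ?laplace_pdf_ge0// le_max lexx orbT.
rewrite [LHS]integral_mkcond; apply: eq_integral => z _.
rewrite patchE; case: ifPn => //; rewrite notin_setE/= in_itv/= oppr0 => /negP.
by rewrite -ltNge => z0; rewrite max_r ?mul0r// oppr_le0 ltW.
Qed.
End laplace.

(** * Mean and variance of a Laplace random variable *)

Section laplace_moments.
Context d (T : measurableType d) (R : realType) (P : probability T R).
Variables (X : {RV P >-> R}) (b : R).
Hypotheses (b0 : 0 < b) (lawX : has_laplace_law X b).
Notation mu := (@lebesgue_measure R).

(** Push forward to the law of [X], then replace the law by its density. All moments of [X] are
    computed through this formula. *)
Lemma ge0_integral_laplace (f : R -> R) :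
  measurable_fun setT f -> (forall z, 0 <= f z) ->
  (\int[P]_w (f (X w))%:E = \int[mu]_z (f z * laplace_pdf b z)%:E)%E.
Proof.
move=> mf f0.
(* [lebesgue_measure] lives on [measurableTypeR R], whose display differs from
   that of [R], so [X] has to be repackaged. *)
have mX : measurable_fun setT (X : T -> measurableTypeR R).
  exact: (@measurable_funPT _ _ _ _ X).
pose X' : {mfun T >-> measurableTypeR R} :=
  HB.pack (X : T -> measurableTypeR R) (isMeasurableFun.Build _ _ _ _ _ mX).
have mEf : measurable_fun [set: measurableTypeR R] (EFin \o f) by exact/measurable_EFinP.
rewrite -(@ge0_integral_distribution _ _ _ _ _ P X' (EFin \o f))//.
rewrite (@ge0_integral_density _ (measurableTypeR R) R mu (distribution P X') (laplace_pdf b))//.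
- exact: continuous_measurable_fun (@continuous_laplace_pdf _ b).
- by move=> z; exact: laplace_pdf_ge0.
Qed.

Lemma laplace_second_moment : ('E_P[((X : T -> R) ^+ 2)%R] = (2 * b ^+ 2)%:E)%E.
Proof.
rewrite unlock -laplace_pdf_second_moment//.
apply: (@ge0_integral_laplace (fun z => z ^+ 2)); first exact: exprn_measurable.
by move=> z; exact: sqr_ge0.
Qed.

Lemma laplace_Lfun2 : (X : T -> R) \in Lfun P 2%:E.
Proof.
rewrite inE; apply/andP; split; rewrite inE//= /finite_norm unlock /=.
apply: poweR_lty.
under eq_integral do rewrite powR_mulrn// real_normK ?num_real//.
by have := laplace_second_moment; rewrite unlock => ->; rewrite ltry.
Qed.

Lemma laplace_expectation : ('E_P[X] = 0)%E.
Proof.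
have X1 := Lfun_subset12 (fin_num_measure P _ measurableT) laplace_Lfun2.
have /Lfun1_integrable iX := X1.
rewrite unlock integralE.
have -> : (\int[P]_w ((fun w => (X w)%:E)^\+ w) = \int[P]_w (Num.max (X w) 0)%:E)%E.
  by apply: eq_integral => w _; rewrite EFin_max funeposE.
have -> : (\int[P]_w ((fun w => (X w)%:E)^\- w) = \int[P]_w (Num.max (- X w) 0)%:E)%E.
  by apply: eq_integral => w _; rewrite EFin_max funenegE.
have mmax0 : measurable_fun setT (fun z : R => Num.max z 0) by exact: measurable_maxr.
(* Finiteness ensures that the difference of the two equal integrals is 0 and not an undefined
   difference of infinities. *)
have fin : (\int[P]_w (Num.max (X w) 0)%:E \is a fin_num)%E.
  have := integrable_fin_num measurableT (integrable_funepos measurableT iX).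
  by congr (_ \is a fin_num); apply: eq_integral => w _; rewrite EFin_max funeposE.
rewrite (@ge0_integral_laplace (fun z => Num.max z 0))// in fin *; last first.
  by move=> z; rewrite le_max lexx orbT.
rewrite (@ge0_integral_laplace (fun z => Num.max (- z) 0))//; last 2 first.
- exact: measurable_maxr.
- by move=> z; rewrite le_max lexx orbT.
by rewrite -laplace_pdf_first_moment_sym// subee.
Qed.

Lemma laplace_variance : ('V_P[X] = (2 * b ^+ 2)%:E)%E.
Proof.
by rewrite varianceE ?laplace_Lfun2// laplace_expectation laplace_second_moment expe2 mule0 sube0.
Qed.
End laplace_moments.

(** * Variance of a sum of uncorrelated variables *)

Section uncorrelated.
Context d (T : measurableType d) (R : realType) (P : probability T R).

Lemma covariance_sumr_eq0 (I : eqType) (r : seq I) (X : T -> R) (Y : I -> T -> R) :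
  X \in Lfun P 2%:E -> (forall i, Y i \in Lfun P 2%:E) ->
  (forall i, i \in r -> covariance P X (Y i) = 0%E) ->
  covariance P X (\sum_(i <- r) Y i) = 0%E.
Proof.
move=> X2 Y2; elim: r => [|i r IH] XY0; first by rewrite big_nil covariance_cst_r.
rewrite big_cons covarianceDr//; last by rewrite rpred_sum// lee1n.
rewrite XY0 ?mem_head// add0e IH// => j jr.
by rewrite XY0// inE jr orbT.
Qed.

Lemma variance_sum_uncorrelated (I : eqType) (r : seq I) (X : I -> T -> R) :
  uniq r -> (forall i, X i \in Lfun P 2%:E) ->
  (forall i j, i != j -> covariance P (X i) (X j) = 0%E) ->
  ('V_P[(\sum_(i <- r) X i)%R] = \sum_(i <- r) 'V_P[X i])%E.
Proof.
move=> + X2 X0; elim: r => [|i r IH] /=; first by rewrite !big_nil variance_cst.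
move=> /andP[ir ur]; rewrite !big_cons varianceD//; last by rewrite rpred_sum// lee1n.
rewrite IH// covariance_sumr_eq0 ?mule0 ?adde0// => j jr.
(* Since the list has no duplicates, its head differs from every later index. *)
by rewrite X0//; apply: contraNneq ir => ->.
Qed.

End uncorrelated.

(** * Independence and expectation of products *)

Section independence.
Context d (T : measurableType d) (R : realType) (P : probability T R).

(** Taking the whole line at every index other than [i] and [j] turns the remaining factors into
    1. *)
Lemma mutually_independent_pair (k : nat) (Z : 'I_k -> {RV P >-> R}) i j
    (A B : set R) : mutually_independent Z -> i != j ->
  measurable A -> measurable B ->
  P (Z i @^-1` A `&` Z j @^-1` B) = (P (Z i @^-1` A) * P (Z j @^-1` B))%E.
Proof.
move=> indepZ ij mA mB.
pose C l := if l == i then A else if l == j then B else setT.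
have mC l : measurable (C l) by rewrite /C; do 2?case: ifP.
have ji : (j == i) = false by rewrite eq_sym (negbTE ij).
have := indepZ C mC.
rewrite (bigD1 i)//= (bigD1 j) ?ji//= big1; last first.
  move=> l /andP[li lj].
  by rewrite /C (negbTE li) (negbTE lj) preimage_setT probability_setT.
rewrite mule1 /C eqxx ji eqxx => <-; congr (P _).
apply/seteqP; split=> [w [Aw Bw] l _ /=|w Cw]; last first.
  split; first by have := Cw i Logic.I; rewrite /= eqxx.
  by have := Cw j Logic.I; rewrite /= ji eqxx.
by case: eqP => [->//|_]; case: eqP => [->|].
Qed.

(** The joint law of [(X, Y)] is the product of the marginal laws, and Fubini splits the integral of
    the coordinate product. *)
Lemma expectation_prod_indep (X Y : {RV P >-> R}) :
  (forall A B : set R, measurable A -> measurable B ->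
    P (X @^-1` A `&` Y @^-1` B) = (P (X @^-1` A) * P (Y @^-1` B))%E) ->
  (X : T -> R) \in Lfun P 2%:E -> (Y : T -> R) \in Lfun P 2%:E ->
  ('E_P[(X \* Y)%R] = 'E_P[X] * 'E_P[Y])%E.
Proof.
move=> indep X2 Y2.
have Pfin : P setT \is a fin_num := fin_num_measure P _ measurableT.
have X1 := Lfun_subset12 Pfin X2.
have Y1 := Lfun_subset12 Pfin Y2.
have /Lfun1_integrable iXY := Lfun2_mul_Lfun1 X2 Y2.
pose XY w := (X w, Y w).
have mXY : measurable_fun setT XY by exact: measurable_fun_pair.
pose f (p : R * R) := (p.1 * p.2)%:E.
have mf : measurable_fun setT f.
  by apply/measurable_EFinP; exact: measurable_funM.
(* A product measure is determined by its values on rectangles, where independence gives the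
   equality. *)
have lawXY A : measurable A ->
    (distribution P X \x distribution P Y)%E A = pushforward P XY A.
  apply: product_measure_unique => B C mB mC.
  by rewrite /= /pushforward -indep.
(* Fubini needs integrability under the product law; it comes from that of [X * Y], a product of
   square integrable variables. *)
have if_ : (distribution P X \x distribution P Y)%E.-integrable setT f.
  have /integrableP[_ fley] : (pushforward P XY).-integrable setT f.
    exact: (integrable_pushforward mXY).
  apply/integrableP; split=> //.
  by rewrite (eq_measure_integral (pushforward P XY))// => A mA _; exact: lawXY.
have EX : (\int[distribution P X]_x x%:E = 'E_P[X])%E.
  rewrite unlock integral_distribution//=; exact/Lfun1_integrable.
have EY : (\int[distribution P Y]_x x%:E = 'E_P[Y])%E.
  rewrite unlock integral_distribution//=; exact/Lfun1_integrable.
transitivity (\int[pushforward P XY]_p f p)%E.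
  by rewrite (integral_pushforward mXY)// unlock.
rewrite -(eq_measure_integral (pushforward P XY) (fun A mA _ => lawXY A mA)).
rewrite -integral12_prod_meas1// /fubini_F /f /=.
(* The inner integral is u times the mean of [Y], made a real scalar by [fineK] so that it can leave
   the outer integral. *)
under eq_integral => u _.
  under eq_integral do rewrite EFinM.
  rewrite integralZl//; last first.
    by apply: integrable_pushforward => //; exact/Lfun1_integrable.
  rewrite EY -[X in (_ * X)%E]fineK ?expectation_fin_num//; over.
rewrite integralZr//; last first.
  by apply: integrable_pushforward => //; exact/Lfun1_integrable.
by rewrite EX fineK ?expectation_fin_num.
Unshelve. exact: mXY.
Qed.
End independence.

(** * The estimator as a constant plus weighted noise *)

Section noisy_counts.
Context d (T : measurableType d) (R : realType) (P : probability T R).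

(** The weights sum to 1, and are inversely proportional to the number of noise terms, two and four,
    in the two estimates. *)
Lemma combined_statistics (n : nat) (x y : 'I_n -> R) :
  2 / 3 * (S_x2 x + S_xmx2 x) +
  1 / 3 * (S_xy x y + S_1mxy x y + S_1my y - S_1mx x) = S_x x.
Proof.
have -> : S_x2 x + S_xmx2 x = S_x x.
  by rewrite -big_split; apply: eq_bigr => i _ /=; ring.
have -> : S_xy x y + S_1mxy x y + S_1my y - S_1mx x = S_x x.
  rewrite /S_1mx -sumrN -!big_split; apply: eq_bigr => i _ /=; ring.
by field.
Qed.

Definition hatS_x_coef (i : 'I_6) : R :=
  if (i < 2)%N then 2 / 3 else if (i == 2 :> nat) then - (1 / 3) else 1 / 3.

(** An explicit list, so that sums over it unfold to the very ordinals used in the noisy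
    statistics. *)
Definition noise_index : seq 'I_6 :=
  [:: @Ordinal 6 0 isT; @Ordinal 6 1 isT; @Ordinal 6 2 isT;
      @Ordinal 6 3 isT; @Ordinal 6 4 isT; @Ordinal 6 5 isT].

Lemma hatS_x_noiseE (n : nat) (x y : 'I_n -> R) (Z : 'I_6 -> {RV P >-> R}) :
  hatS_x x y Z = cst (S_x x) \+
    \sum_(i <- noise_index) hatS_x_coef i \o* (Z i : T -> R).
Proof.
apply/funext => w; rewrite /= fct_sumE /noise_index !big_cons big_nil /=.
rewrite -(combined_statistics x y) /hatS_x /tn_y /tS_x2 /tS_xmx2 /tS_1mx /tS_xy
  /tS_1mxy /tS_1my /hatS_x_coef /=.
ring.
Qed.

End noisy_counts.

(** * Mean and variance of the estimator *)

Theorem mainTheorem11 (R : realType) (d : measure_display) (T : measurableType d)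
  (P : probability T R) (eps : R) (n : nat) (x y : 'I_n -> R)
  (Z : 'I_6 -> {RV P >-> R}) :
  0 < eps ->
  (forall i, 0 <= x i <= 1) -> (forall i, 0 <= y i <= 1) ->
  mutually_independent Z ->
  (* eps1 = eps2 = eps/2; Z_1j ~ Lap(1/eps1), Z_2j ~ Lap(1/eps2) *)
  (forall i : 'I_6, (i < 3)%N -> has_laplace_law (Z i) (1 / (eps / 2))) ->
  (forall i : 'I_6, (3 <= i)%N -> has_laplace_law (Z i) (1 / (eps / 2))) ->
  ('E_P[hatS_x x y Z] = (S_x x)%:E /\
   'V_P[hatS_x x y Z] = (32 / (3 * eps ^+ 2))%:E)%E.
Proof.
move=> eps0 _ _ indepZ law1 law2.
pose b := 1 / (eps / 2).
have b0 : 0 < b by rewrite divr_gt0// divr_gt0.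
have lawZ i : has_laplace_law (Z i) b.
  by have [i3|i3] := ltnP i 3; [exact: law1|exact: law2].
have Z2 i : (Z i : T -> R) \in Lfun P 2%:E := laplace_Lfun2 b0 (lawZ i).
have Pfin : P setT \is a fin_num := fin_num_measure P _ measurableT.
have Z1 i : (Z i : T -> R) \in Lfun P 1 := Lfun_subset12 Pfin (Z2 i).
pose N i : T -> R := hatS_x_coef R i \o* (Z i : T -> R).
have N2 i : N i \in Lfun P 2%:E by rewrite Lfun_scale// ler1n.
have N1 i : N i \in Lfun P 1 := Lfun_subset12 Pfin (N2 i).
(* The coefficients come out of the covariance; the product rule and the zero means do the rest. *)
have covN i j : i != j -> covariance P (N i) (N j) = 0%E.
  move=> ij.
  rewrite covarianceZl//; last exact: Lfun2_mul_Lfun1 (Z2 i) (N2 j).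
  rewrite covarianceZr ?Lfun2_mul_Lfun1//.
  rewrite covarianceE ?Lfun2_mul_Lfun1//.
  rewrite expectation_prod_indep//; last first.
    by move=> A B mA mB; exact: mutually_independent_pair.
  by rewrite !(laplace_expectation b0 (lawZ _)) mule0 sube0 !mule0.
have S2 : \sum_(i <- noise_index) N i \in Lfun P 2%:E by rewrite rpred_sum// lee1n.
have S1 := Lfun_subset12 Pfin S2.
rewrite (_ : hatS_x x y Z = cst (S_x x) \+ \sum_(i <- noise_index) N i);
  last exact: hatS_x_noiseE.
split.
  rewrite expectationD; [|exact: Lfun_cst|exact: S1].
  rewrite expectation_cst.
  (* [expectation_sum] is applied to a list of functions, hence the passage to the mapped list. *)
  rewrite -(big_map N predT id) expectation_sum; last by move=> _ /mapP[i _ ->].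
  rewrite big_map big1 ?adde0// => i _.
  by rewrite expectationZl// (laplace_expectation b0 (lawZ i)) mule0.
rewrite varianceD_cst_l//.
rewrite variance_sum_uncorrelated//.
under eq_bigr => i _.
  rewrite varianceZ// (laplace_variance b0 (lawZ i)) -EFinM; over.
rewrite sumEFin; congr EFin.
(* The squared coefficients sum to 4/3, and each noise has variance 8 / eps^2. *)
rewrite /noise_index !big_cons big_nil /hatS_x_coef /b /=.
by field; rewrite gt_eqF.
Qed.
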